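(* Let $S\subset\mathbb{R}^n$ be a surface with band $B(S)$ (as in the context), and let $r:B(S)\to S$ be a $C^1$-retraction. Suppose that for every $m\ge1$ and every continuously differentiable surface function $f:S\to\mathbb{R}^m$, $$D[f\circ r](y)=D_Sf(y)\qquad\text{for all } y\in S.$$ Then $Dr(y)=P(y)$ for all $y\in S$, and thus $r$ is a closest point function.
   Context: Surfaces. $S$ is an embedded $C^2$-submanifold of $\mathbb{R}^n$ without boundary (if there is a boundary, $S$ is identified with its interior), of dimension $k\le n$, possessing a tubular neighborhood $B(S)\subset\mathbb{R}^n$, an open set containing $S$, called a band around $S$. $S$ is orientable in the sense that, if $k<n$, there are smooth unit vector fields $N_1,\dots,N_{n-k}:S\to\mathbb{R}^n$ spanning the normal space $\mathcal{N}_yS$ at each $y\in S$. $\mathcal{T}_yS$ is the tangent space, and $P(y)\in\mathbb{R}^{n\times n}$ is the orthogonal projector of $\mathbb{R}^n$ onto $\mathcal{T}_yS$. $C^1$-retraction. A map $r:B(S)\to S$ that is continuously differentiable (as a map into $\mathbb{R}^n$) with $r(y)=y$ for all $y\in S$. A closest point function is a $C^1$-retraction $r:B(S)\to S$ with $Dr(y)=P(y)$ for all $y\in S$. Surface Jacobian. For a $C^1$ function $f:S\to\mathbb{R}^m$ and $y\in S$, let $f_E:\Omega_E\to\mathbb{R}^m$ be any $C^1$ extension of $f$ near $y$: $\Omega_E\subset\mathbb{R}^n$ is open, contains $y$, and $f_E=f$ on $S\cap\Omega_E$. Then $D_Sf(y):=Df_E(y)\cdot P(y)$ (independent of the chosen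 extension). $D$ without subscript is the ordinary Jacobian in $\mathbb{R}^n$. *)

(* Defs.v *)
(* Points of R^n are row vectors 'rV[R]_n. *)
From HB Require Import structures.
From mathcomp Require Import all_boot all_order all_algebra.
From mathcomp Require Import boolp classical_sets functions reals.
From mathcomp Require Import topology normedtype derive.

Set Implicit Arguments.
Unset Strict Implicit.
Unset Printing Implicit Defensive.

Import Order.TTheory GRing.Theory Num.Theory.
Import numFieldNormedType.Exports.

Local Open Scope classical_set_scope.
Local Open Scope ring_scope.

(* f is of class C^j on the set O, which is open in every use below; V is
   finite dimensional in every use below, so that the continuity of all the
   directional derivatives is the continuity of the differential. *)
Fixpoint class_C (R : realType) (V W : normedModType R) (j : nat) (O : set V)
    (f : V -> W) : Prop :=
  if j is i.+1 then
    (forall x, O x -> differentiable f x) /\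
    (forall v, class_C i O (fun x => 'D_v f x))
  else forall x, O x -> {for x, continuous f}.

(* The library's 'J f y acts on row vectors from the right; the Jacobian in the
   usual convention, with one row per component of f, is its transpose. *)
Definition Jac (R : realType) (n m : nat) (f : 'rV[R]_n -> 'rV[R]_m)
    (y : 'rV[R]_n) : 'M[R]_(m, n) := ('J f y)^T.

Definition dotp (R : realType) (n : nat) (u v : 'rV[R]_n) : R :=
  \sum_(i < n) u 0 i * v 0 i.

(* Slice charts: near each of its points, S is straightened to R^k x {0} by a
   C^2-diffeomorphism phi : U -> V with inverse psi. *)
Definition embedded_C2_submanifold (R : realType) (n k : nat)
    (S : set 'rV[R]_n) : Prop :=
  (k <= n)%N /\
  forall y, S y -> exists (U V : set 'rV[R]_n) (phi psi : 'rV[R]_n -> 'rV[R]_n),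
    [/\ open U, U y & open V] /\
    [/\ class_C 2 U phi, class_C 2 V psi,
        (forall x, U x -> V (phi x) /\ psi (phi x) = x) &
        (forall z, V z -> U (psi z) /\ phi (psi z) = z)] /\
    (forall x, U x -> (S x <-> forall i : 'I_n, (k <= i)%N -> phi x 0 i = 0)).

Definition tangent_space (R : realType) (n : nat) (S : set 'rV[R]_n)
    (y : 'rV[R]_n) : set 'rV[R]_n :=
  [set v | exists (e : R) (c : R -> 'rV[R]_n),
    [/\ 0 < e, class_C 1 (ball (0 : R) e) c,
        (forall t, ball (0 : R) e t -> S (c t)), c 0 = y & derive1 c 0 = v]].

Definition normal_space (R : realType) (n : nat) (S : set 'rV[R]_n)
    (y : 'rV[R]_n) : set 'rV[R]_n :=
  [set w | forall v, tangent_space S y v -> dotp w v = 0].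

(* x *m Q^T is Q applied to the column vector x^T. *)
Definition is_orthogonal_projector (R : realType) (n : nat)
    (E : set 'rV[R]_n) (Q : 'M[R]_n) : Prop :=
  forall x : 'rV[R]_n,
    E (x *m Q^T) /\ forall v, E v -> dotp (x - x *m Q^T) v = 0.

(* P(y); the tangent space of an embedded C^2-submanifold is linear, so that
   such a matrix exists and is unique. *)
Definition tangent_projector (R : realType) (n : nat) (S : set 'rV[R]_n)
    (y : 'rV[R]_n) : 'M[R]_n :=
  get (is_orthogonal_projector (tangent_space S y)).

(* A map on S is represented by a function on R^n whose values outside S play
   no role. *)
Definition C1_extension (R : realType) (n m : nat) (S : set 'rV[R]_n)
    (f : 'rV[R]_n -> 'rV[R]_m) (y : 'rV[R]_n)
    (O : set 'rV[R]_n) (fE : 'rV[R]_n -> 'rV[R]_m) : Prop :=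
  [/\ open O, O y, class_C 1 O fE & forall x, S x -> O x -> fE x = f x].

Definition C1_surface_function (R : realType) (n m : nat) (S : set 'rV[R]_n)
    (f : 'rV[R]_n -> 'rV[R]_m) : Prop :=
  forall y, S y -> exists O fE, C1_extension S f y O fE.

(* D_S f (y); the matrix does not depend on the extension. *)
Definition surface_Jac (R : realType) (n m : nat) (S : set 'rV[R]_n)
    (f : 'rV[R]_n -> 'rV[R]_m) (y : 'rV[R]_n) : 'M[R]_(m, n) :=
  get [set J | exists O fE, C1_extension S f y O fE /\
                 J = Jac fE y *m tangent_projector S y].

Definition orientable (R : realType) (n k : nat) (S : set 'rV[R]_n) : Prop :=
  (k < n)%N -> exists N : 'I_(n - k) -> 'rV[R]_n -> 'rV[R]_n,
    (forall i, C1_surface_function S (N i)) /\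
    forall y, S y ->
      (forall i, dotp (N i y) (N i y) = 1) /\
      normal_space S y =
        [set w | exists a : 'I_(n - k) -> R, w = \sum_i a i *: N i y].

Definition normal_bundle (R : realType) (n : nat) (S : set 'rV[R]_n) :
    set ('rV[R]_n * 'rV[R]_n) :=
  [set p | S p.1 /\ normal_space S p.1 p.2].

(* (x, v) |-> x + v maps an open neighbourhood of the zero section of the normal
   bundle diffeomorphically onto B.  Its inverse is b |-> (q b, b - q b), which
   is C^1 exactly when q is. *)
Definition tubular_neighborhood (R : realType) (n : nat)
    (S B : set 'rV[R]_n) : Prop :=
  [/\ open B, S `<=` B &
      exists (U : set ('rV[R]_n * 'rV[R]_n)) (q : 'rV[R]_n -> 'rV[R]_n),
        [/\ open U, (forall y, S y -> U (y, 0)),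
            (fun p => p.1 + p.2) @` (U `&` normal_bundle S) = B,
            class_C 1 B q &
            forall p, (U `&` normal_bundle S) p -> q (p.1 + p.2) = p.1]].

Definition surface_with_band (R : realType) (n k : nat)
    (S B : set 'rV[R]_n) : Prop :=
  [/\ embedded_C2_submanifold k S, orientable k S & tubular_neighborhood S B].

Definition C1_retraction (R : realType) (n : nat) (S B : set 'rV[R]_n)
    (r : 'rV[R]_n -> 'rV[R]_n) : Prop :=
  [/\ class_C 1 B r, (forall x, B x -> S (r x)) & forall y, S y -> r y = y].

Definition closest_point_function (R : realType) (n : nat)
    (S B : set 'rV[R]_n) (r : 'rV[R]_n -> 'rV[R]_n) : Prop :=
  C1_retraction S B r /\ forall y, S y -> Jac r y = tangent_projector S y.

(* Main.v *)
(** Apply the hypothesis to [f := id]: then [Dr(y) = Df_E(y) P(y)] for some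
    C^1 map [f_E] agreeing with the identity on [S] near [y]. Differentiating
    [f_E (c t) = c t] along curves of [S] shows that [Df_E(y)] fixes every
    tangent vector, hence [Df_E(y) P(y) = P(y)], provided that [P(y)] really
    has its range in the tangent space. This is so because the tangent space is
    the range of [Dr(y)] (use the curves [r (y + t v)]), hence linear, and so
    the orthogonal projector onto it exists. *)
Require Import Defs.
From HB Require Import structures.
From mathcomp Require Import all_boot all_order all_algebra.
From mathcomp Require Import boolp classical_sets functions reals.
From mathcomp Require Import topology normedtype derive.

Import Order.TTheory GRing.Theory Num.Theory.
Import numFieldNormedType.Exports.

Local Open Scope classical_set_scope.
Local Open Scope ring_scope.

Lemma dotpE (R : realType) (n : nat) (u v : 'rV[R]_n) :
  dotp u v = (u *m v^T) 0 0.
Proof. by rewrite mxE; apply: eq_bigr => i _; rewrite mxE. Qed.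

Lemma dotpp_eq0 (R : realType) (n : nat) (u : 'rV[R]_n) :
  dotp u u = 0 -> u = 0.
Proof.
move=> /eqP; rewrite psumr_eq0 => [/allP u0|i _]; last first.
  by rewrite -expr2 sqr_ge0.
apply/rowP => i; rewrite mxE; apply/eqP.
by have := u0 i (mem_index_enum _); rewrite /= mulf_eq0 orbb.
Qed.

(** If [u *m (A *m A^T) = 0], then [u *m A] has zero dot product with itself, so it vanishes, and
    [u = 0] because the rows of [A] are independent. *)
Lemma gram_unitmx (R : realType) (m n : nat) (A : 'M[R]_(m, n)) :
  row_free A -> A *m A^T \in unitmx.
Proof.
move=> Afree; rewrite -row_free_unit; apply/inj_row_free => u uG0.
apply: (row_free_inj Afree); rewrite mul0mx; apply: dotpp_eq0.
by rewrite dotpE trmx_mul mulmxA -(mulmxA u) uG0 mul0mx mxE.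
Qed.

Lemma orthogonal_projector_submx (R : realType) (m n : nat)
    (A : 'M[R]_(m, n)) :
  exists Q : 'M[R]_n,
    is_orthogonal_projector [set v : 'rV[R]_n | (v <= A)%MS] Q.
Proof.
have Cfree := row_base_free A; have CA := eq_row_base A.
move: (row_base A) Cfree CA => C Cfree CA.
(* The least squares formula for a basis [C] of the row space of [A]. The outer transpose
   compensates for [Q^T] acting on rows. *)
exists (C^T *m invmx (C *m C^T) *m C)^T => x; rewrite trmxK; split=> [/=|v /=].
  by rewrite -CA mulmxA submxMl.
rewrite -CA => /submxP[w ->].
rewrite dotpE trmx_mul mulmxBl -!mulmxA (mulmxA C) mulKmx ?gram_unitmx//.
by rewrite subrr mxE.
Qed.

(** Chain rule for [g \o c = c], which holds only near 0, where continuity keeps [c t] in [O]. *)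
Lemma tangent_fixed (R : realType) (n : nat) (S O : set 'rV[R]_n)
    (g : 'rV[R]_n -> 'rV[R]_n) (y v : 'rV[R]_n) :
  C1_extension S id y O g -> tangent_space S y v -> v *m 'J g y = v.
Proof.
move=> [oO Oy [dg _] gS] [e [c [e0 [dc _] cS cy cv]]]; subst y v.
have dc0 : differentiable c 0 by apply: dc; exact: ballxx.
have dgc : differentiable g (c 0) by exact: dg.
have gc : \forall t \near (0 : R), (g \o c) t = c t.
  near=> t; apply: gS.
    by apply: cS; near: t; exact: nbhsx_ballx.
  near: t; apply: (differentiable_continuous dc0).
  exact: open_nbhs_nbhs.
rewrite -deriveEjacobian// deriveE// derive1E -[RHS](near_eq_derive _ gc).
rewrite [in RHS]deriveE; last exact: differentiable_comp.
by rewrite (diff_comp dc0 dgc) deriveE.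
Unshelve. all: by end_near. Qed.

Lemma is_diff_line (R : realType) (n : nat) (y v : 'rV[R]_n) (t : R) :
  is_diff t (fun s : R => y + s *: v) (fun s : R => s *: v).
Proof.
have dl : is_diff t (fun s : R => s *: v) (fun s : R => s *: v).
  exact: is_diff_scalel.
by have := is_diffD (is_diff_cst y t) dl; rewrite add0r.
Qed.

Lemma tangent_retraction (R : realType) (n : nat) (S B : set 'rV[R]_n)
    (r : 'rV[R]_n -> 'rV[R]_n) (y v : 'rV[R]_n) :
  open B -> B y -> S y -> C1_retraction S B r ->
  tangent_space S y (v *m 'J r y).
Proof.
move=> oB By Sy [[dr cr] rS rid].
pose a (t : R) := y + t *: v.
have da t : differentiable a t by have [] := is_diff_line _ _ y v t.
have diffa t : 'd a t = (fun s : R => s *: v) :> (R -> _).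
  by have [_] := is_diff_line _ _ y v t.
have a0 : a 0 = y by rewrite /a scale0r addr0.
(* Nothing is known of [r] outside [B], so the line is cut down to parameters that keep it in the
   open set [B]. *)
have : nbhs (0 : R) (a @^-1` B).
  apply: (differentiable_continuous (da 0)).
  by rewrite a0; exact: open_nbhs_nbhs.
move=> /nbhs_ballP[e /= e0 eB].
(* This formula reduces the continuity of the derivative of the curve to that of ['D_v r] on [B]. *)
have Dc t w : ball (0 : R) e t -> 'D_w (r \o a) t = w *: 'D_v r (a t).
  move=> /eB Bat; have dra : differentiable r (a t) by exact: dr.
  rewrite deriveE; last exact: differentiable_comp.
  by rewrite diff_comp//= diffa linearZ deriveE.
exists e, (r \o a); split=> //.
- split=> [t /eB Bat|w t et].
    by apply: differentiable_comp => //; exact: dr.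
  have near_t : \forall s \near t, w *: 'D_v r (a s) = 'D_w (r \o a) s.
    near=> s; rewrite Dc//; near: s.
    by apply: open_nbhs_nbhs; split=> //; exact: ball_open.
  apply: cvg_trans (near_eq_cvg near_t) _.
  rewrite Dc//; apply: cvgZr.
  apply: (@continuous_comp _ _ _ a ('D_v r)).
    exact: differentiable_continuous.
  by apply: cr; exact: eB.
- by move=> t /eB; exact: rS.
- by rewrite /= a0 rid.
- rewrite derive1E Dc ?scale1r ?a0; last exact: ballxx.
  by rewrite deriveEjacobian//; exact: dr.
Unshelve. all: by end_near. Qed.

(** [get] is meaningful only once some projector exists; it does because the tangent space is the
    row space of ['J r y]. *)
Lemma tangent_projector_orthogonal (R : realType) (n : nat)
    (S B : set 'rV[R]_n) (r : 'rV[R]_n -> 'rV[R]_n) (y : 'rV[R]_n) :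
  open B -> B y -> S y -> C1_retraction S B r ->
  is_orthogonal_projector (tangent_space S y) (tangent_projector S y).
Proof.
move=> oB By Sy hr; rewrite /tangent_projector.
have [Q Qproj] := orthogonal_projector_submx _ _ _ ('J r y).
suff TE : tangent_space S y = [set v : 'rV[R]_n | (v <= 'J r y)%MS].
  by apply: getPex; exists Q; rewrite TE.
apply/seteqP; split=> v /= => [vT|/submxP[u ->]]; last first.
  exact: tangent_retraction hr.
have [C1r _ rid] := hr.
(* [r] is itself a C^1 extension of the identity of [S], so [v = v *m 'J r y]. *)
rewrite -(@tangent_fixed _ _ S B r y v _ vT) ?submxMl//.
by split=> // x Sx _; exact: rid.
Qed.

Lemma C1_surface_function_id (R : realType) (n : nat) (S : set 'rV[R]_n) :
  C1_surface_function S (@id 'rV[R]_n).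
Proof.
move=> y Sy; exists setT, id; split=> //; first exact: openT.
split=> [//|v x _].
rewrite (_ : (fun x => _) = cst v); first exact: cst_continuous.
by apply/funext => z; rewrite derive_id.
Qed.

Theorem theorem3p3 (R : realType) (n k : nat) (S B : set 'rV[R]_n)
    (r : 'rV[R]_n -> 'rV[R]_n)
    (hS : surface_with_band k S B)
    (hr : C1_retraction S B r)
    (hD : forall (m : nat), (1 <= m)%N -> forall (f : 'rV[R]_n -> 'rV[R]_m),
      C1_surface_function S f ->
      forall y, S y -> Jac (f \o r) y = surface_Jac S f y) :
  (forall y, S y -> Jac r y = tangent_projector S y) /\
  closest_point_function S B r.
Proof.
suff JP y : S y -> Jac r y = tangent_projector S y by split=> //; split.
move=> Sy; have [_ _ [oB SB _]] := hS.
have Pproj := tangent_projector_orthogonal _ _ _ _ _ _ oB (SB _ Sy) Sy hr.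
(* For [n = 0] the identity is not covered by [hD], which asks for [1 <= m]; the matrices are then
   empty. *)
have [n0|n_gt0] := posnP n.
  by apply/matrixP => i; have := ltn_ord i; rewrite {2}n0.
have idS := @C1_surface_function_id R n S.
have [O [g gext]] := idS y Sy.
have Jr := hD n n_gt0 id idS y Sy; rewrite -[LHS]/(Jac (id \o r) y) Jr.
(* The extension [h] chosen by [get] may differ from [g], which only shows that there is one to
   choose. *)
have [|O' [h [hext]]] := @getPex _ [set J | exists O fE,
    C1_extension S id y O fE /\ J = Jac fE y *m tangent_projector S y].
  by eexists; exists O, g; split.
rewrite -/(surface_Jac S id y) => ->.
apply: trmx_inj; rewrite trmx_mul trmxK.
(* The rows of the transposed projector are the projections of the basis vectors, hence tangent and
   fixed by ['J h y]. *)
apply/row_matrixP => i; rewrite row_mul.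
by apply: tangent_fixed hext _; rewrite rowE; have [] := Pproj (delta_mx 0 i).
Qed.
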